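(* Let $\mu>0$ and $0<r\le\sqrt{\mu}$ be real numbers. Then the function $$\mathbb{Q}_{\mu}(r;z)=z+\sum_{n=2}^{\infty}\frac{n!\,(r^2+1)^{\mu+1}}{((n!)^2+r^2)^{\mu+1}}z^n,\qquad z\in\mathbb{U},$$ is close-to-convex in $\mathbb{U}$ with respect to the starlike function $g(z)=z/(1-z)$.
   Context: $\mathbb{U}=\{z\in\mathbb{C}:|z|<1\}$ is the open unit disk, and $\mathscr{A}$ is the class of analytic functions $f$ on $\mathbb{U}$ with $f(0)=0$ and $f'(0)=1$. A function $f\in\mathscr{A}$ is called starlike if it maps $\mathbb{U}$ onto a domain that is starlike with respect to the origin; analytically, starlike functions are characterized by $\Re\left(zf'(z)/f(z)\right)>0$ for all $z\in\mathbb{U}$ (the quotient being understood as its limit $1$ at $z=0$). For a starlike function $g$, a function $f\in\mathscr{A}$ is called close-to-convex with respect to $g$ if there is $\theta\in\mathbb{R}$ such that $\Re\left\{e^{i\theta}zf'(z)/g(z)\right\}>0$ for all $z\in\mathbb{U}$ (the quotient at $z=0$ being understood as its limit). *)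

(* Defs.v *)
From Stdlib Require Import Reals Factorial Lra.
From Coquelicot Require Import Coquelicot.
Local Open Scope R_scope.

Definition unit_disk (z : C) : Prop := Cmod z < 1.

Definition analytic_on (D : C -> Prop) (f : C -> C) : Prop :=
  forall z, D z -> ex_derive (K := C_AbsRing) (V := C_NormedModule) f z.

Definition class_A (f : C -> C) : Prop :=
  analytic_on unit_disk f /\ f 0 = 0 /\ C_derive f 0 = 1.

Definition disk_image (f : C -> C) (w : C) : Prop :=
  exists z, unit_disk z /\ f z = w.

(* Connectedness is not listed: it follows from the last two clauses. *)
Definition starlike_domain (D : C -> Prop) : Prop :=
  open (T := C_UniformSpace) D /\ D 0 /\
  forall (w : C) (t : R), D w -> 0 <= t <= 1 -> D (t * w)%C.

(* Injectivity is the usual convention for starlike functions; it is what makes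
   the geometric condition equivalent to Re (z f'(z) / f(z)) > 0. *)
Definition starlike (f : C -> C) : Prop :=
  class_A f /\
  (forall z w, unit_disk z -> unit_disk w -> f z = f w -> z = w) /\
  starlike_domain (disk_image f).

Definition expi (theta : R) : C := (cos theta, sin theta).

(* At z = 0 the expression z * f'(z) / g(z) has the form 0 / 0, where division
   returns a meaningless value; its value there is the limit. *)
Definition close_to_convex_wrt (g f : C -> C) : Prop :=
  starlike g /\ class_A f /\
  exists theta : R,
    (forall z, unit_disk z -> z <> 0 ->
       0 < Re (expi theta * z * C_derive f z / g z)%C) /\
    (exists l : C,
       filterlim (fun z : C => (expi theta * z * C_derive f z / g z)%C)
         (locally' (T := C_UniformSpace) (RtoC 0)) (locally (T := C_UniformSpace) l) /\
       0 < Re l).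

(* Coquelicot's [Series] is real-valued; see [CSeries_correct]. *)
Definition CSeries (a : nat -> C) : C :=
  (Series (fun n => Re (a n)), Series (fun n => Im (a n))).

Definition Q_coef (mu r : R) (n : nat) : R :=
  INR (fact n) * Rpower (r ^ 2 + 1) (mu + 1)
    / Rpower (INR (fact n) ^ 2 + r ^ 2) (mu + 1).

Definition Q (mu r : R) (z : C) : C :=
  (z + CSeries (fun k => Q_coef mu r (k + 2) * z ^ (k + 2)))%C.

Lemma CSeries_correct (a : nat -> C) :
  ex_series (fun n => Cmod (a n)) ->
  is_series (K := C_AbsRing) (V := C_NormedModule) a (CSeries a).
Proof.
intros H.
assert (Hre : is_series (fun n => Re (a n)) (Series (fun n => Re (a n)))).
{ apply Series_correct, (@ex_series_le R_AbsRing R_CompleteNormedModule) with (2 := H).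
  intros n. eapply Rle_trans; [ | apply Rmax_Cmod ]. apply Rmax_l. }
assert (Him : is_series (fun n => Im (a n)) (Series (fun n => Im (a n)))).
{ apply Series_correct, (@ex_series_le R_AbsRing R_CompleteNormedModule) with (2 := H).
  intros n. eapply Rle_trans; [ | apply Rmax_Cmod ]. apply Rmax_r. }
assert (Hsum : forall n, @sum_n C_NormedModule a n =
  (sum_n (fun n => Re (a n)) n, sum_n (fun n => Im (a n)) n)).
{ induction n as [ | n IH ].
  - rewrite !sum_O. unfold Re, Im. now destruct (a 0%nat).
  - rewrite !sum_Sn, IH. reflexivity. }
unfold is_series.
apply filterlim_locally. intros eps.
generalize (proj1 (filterlim_locally _ _) Hre eps) (proj1 (filterlim_locally _ _) Him eps).
intros H1 H2. generalize (filter_and _ _ H1 H2). apply filter_imp.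
intros n [B1 B2]. rewrite Hsum. split; assumption.
Qed.

Lemma Q_coef_bound (mu r : R) (n : nat) :
  0 < mu -> 0 <= Q_coef mu r n <= Rpower (r ^ 2 + 1) (mu + 1).
Proof.
intros Hmu. unfold Q_coef.
set (K := Rpower (r ^ 2 + 1) (mu + 1)).
set (F := INR (fact n)).
assert (HF : 1 <= F).
{ change 1 with (INR 1). apply le_INR, lt_O_fact. }
assert (HK : 0 < K) by apply exp_pos.
set (B := F ^ 2 + r ^ 2).
assert (HB : F <= B) by (unfold B; nra).
assert (HP : F <= Rpower B (mu + 1)).
{ apply Rle_trans with (1 := HB).
  rewrite <- (Rpower_1 B) at 1 by lra.
  apply Rle_Rpower; lra. }
split.
- apply Rle_div_r; nra.
- apply Rle_div_l; nra.
Qed.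

Lemma Q_converges (mu r : R) (z : C) :
  0 < mu -> unit_disk z ->
  is_series (K := C_AbsRing) (V := C_NormedModule)
    (fun k => (Q_coef mu r (k + 2) * z ^ (k + 2))%C)
    (CSeries (fun k => (Q_coef mu r (k + 2) * z ^ (k + 2))%C)).
Proof.
intros Hmu Hz. apply CSeries_correct.
pose (K := Rpower (r ^ 2 + 1) (mu + 1)).
apply (@ex_series_le R_AbsRing R_CompleteNormedModule) with
  (b := fun k => K * Cmod z ^ 2 * Cmod z ^ k).
- intros k. change norm with Rabs. simpl.
  rewrite Rabs_pos_eq by apply Cmod_ge_0.
  destruct (Q_coef_bound mu r (k + 2) Hmu) as [H0 H1].
  rewrite Cmod_mult, Cmod_R, Cmod_pow, Rabs_pos_eq, pow_add by assumption.
  fold K in H1.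
  replace (K * (Cmod z * (Cmod z * 1)) * Cmod z ^ k)
    with (K * (Cmod z ^ k * Cmod z ^ 2)) by ring.
  apply Rmult_le_compat_r; [ | assumption ].
  apply Rmult_le_pos; apply pow_le, Cmod_ge_0.
- apply (ex_series_scal_l (K * Cmod z ^ 2) (fun k => Cmod z ^ k)).
  apply ex_series_geom. rewrite Rabs_pos_eq; [ exact Hz | apply Cmod_ge_0 ].
Qed.

(* Main.v *)
(* With g(z) = z / (1 - z) and theta = 0 the quotient is (1 - z) f'(z), and
   (1 - z) f'(z) - 1 has the coefficients (n+1) a_(n+1) - n a_n. If n a_n decreases from 1
   and stays nonnegative, these are nonpositive with absolute sum at most 1, so
   |(1 - z) f'(z) - 1| <= |z| < 1; this gives positivity of the real part, the
   limit 1 at the origin, and f'(0) = 1 at once. For Q_mu the monotonicity of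
   n a_n follows from Bernoulli's inequality and r^2 <= mu. *)
Require Import Defs.
From Stdlib Require Import Reals Factorial Lra.
From Coquelicot Require Import Coquelicot.
Local Open Scope R_scope.

(** * Complex derivatives and sums from explicit bounds *)

Lemma locally_Cmod_lt (z : C) (d : R) :
  0 < d -> locally (T := C_UniformSpace) z (fun w => Cmod (w - z) < d).
Proof.
intros Hd. apply locally_C. exists (mkposreal d Hd). now intros w Hw.
Qed.

(** Serves both derivatives needed below, that of a power series and that of [z / (1 - z)]: each has
    an explicit second-order remainder. *)
Lemma is_derive_of_quadratic_bound (f : C -> C) (z l : C) (d M : R) :
  0 < d ->
  (forall w, Cmod (w - z) < d ->
     Cmod (f w - f z - (w - z) * l) <= M * Cmod (w - z) ^ 2) ->
  is_derive (K := C_AbsRing) (V := C_NormedModule) f z l.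
Proof.
intros Hd H. split; [apply is_linear_scal_l |].
intros x Hx.
apply (is_filter_lim_locally_unique (V := AbsRing_NormedModule C_AbsRing)) in Hx.
subst x. intros eps.
assert (He := cond_pos eps).
(* [M] may be zero or negative; [K] is positive, so [eps / K] is a legitimate radius. *)
pose (K := Rmax M 1).
assert (HK : 0 < K) by (unfold K; generalize (Rmax_r M 1); lra).
assert (HMK : M <= K) by apply Rmax_l.
apply locally_C.
apply filter_imp with (2 := locally_Cmod_lt z (Rmin d (eps / K))
  (Rmin_pos _ _ Hd (Rdiv_lt_0_compat _ _ He HK))).
intros w Hw.
change (Cmod (f w - f z - (w - z) * l) <= eps * Cmod (w - z)).
assert (H1 := Rmin_l d (eps / K)). assert (H2 := Rmin_r d (eps / K)).
apply Rle_trans with (1 := H w ltac:(lra)).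
assert (H3 := Cmod_ge_0 (w - z)).
assert (H4 : K * Cmod (w - z) <= eps).
{ apply Rle_trans with (K * (eps / K)).
  - apply Rmult_le_compat_l; lra.
  - apply Req_le. field. lra. }
apply Rle_trans with (K * Cmod (w - z) * Cmod (w - z)); [| nra].
apply Rle_trans with (K * Cmod (w - z) ^ 2); [| nra].
apply Rmult_le_compat_r; [apply pow_le, H3 | exact HMK].
Qed.

(** The triangle inequality bounds every partial sum by [B], and the bound passes to the limit; the
    sum of [b] need not be known. *)
Lemma Cmod_series_le (u : nat -> C) (b : nat -> R) (l : C) (B : R) :
  is_series (K := C_AbsRing) (V := C_NormedModule) u l ->
  (forall n, Cmod (u n) <= b n) ->
  (forall n, sum_n b n <= B) ->
  Cmod l <= B.
Proof.
intros Hu Hb HB.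
assert (Hs : forall n, Cmod (sum_n (G := C_NormedModule) u n) <= sum_n b n).
{ induction n as [| n IH].
  - rewrite !sum_O. apply Hb.
  - rewrite !sum_Sn. eapply Rle_trans; [apply Cmod_triangle |].
    now apply Rplus_le_compat. }
change (Rbar_le (Cmod l) B).
apply (filterlim_le (F := eventually)
  (fun n => Cmod (sum_n (G := C_NormedModule) u n)) (fun _ => B)).
- exists 0%nat. intros n _. eapply Rle_trans; [apply Hs | apply HB].
- apply (filterlim_comp _ _ _ _ _ _ _ _ Hu (filterlim_norm (V := C_NormedModule) l)).
- apply filterlim_const.
Qed.

(** * Power series in the disk *)

(** The remainders satisfy [E' = w * E + (k+1) * z^k * (w - z)^2], which drives an induction. The
    constant is twice the sharp one; its factor [INR (S k)] is the one that the coefficients absorb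
    later. *)
Lemma Cmod_pow_taylor2 (z w : C) (rho : R) (k : nat) :
  Cmod z <= rho -> Cmod w <= rho ->
  Cmod (w ^ S k - z ^ S k - (w - z) * (INR (S k) * z ^ k))
    <= INR (S k) * INR k * rho ^ Nat.pred k * Cmod (w - z) ^ 2.
Proof.
intros Hz Hw.
assert (Hz0 := Cmod_ge_0 z). assert (Hw0 := Cmod_ge_0 w).
assert (Hrho : 0 <= rho) by lra.
assert (Hh := pow2_ge_0 (Cmod (w - z))).
induction k as [| k IH].
- replace (w ^ 1 - z ^ 1 - (w - z) * (INR 1 * z ^ 0))%C with (RtoC 0)
    by (simpl; ring).
  rewrite Cmod_0. simpl. lra.
- set (E := (w ^ S k - z ^ S k - (w - z) * (INR (S k) * z ^ k))%C) in *.
  replace (w ^ S (S k) - z ^ S (S k) - (w - z) * (INR (S (S k)) * z ^ S k))%C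
    with (w * E + INR (S k) * z ^ k * (w - z) ^ 2)%C
    by (unfold E; rewrite (S_INR (S k)), RtoC_plus; simpl Cpow; ring).
  eapply Rle_trans; [apply Cmod_triangle |].
  rewrite !Cmod_mult, !Cmod_pow, Cmod_R, (Rabs_pos_eq _ (pos_INR _)).
  set (h := Cmod (w - z) ^ 2) in *.
  simpl Nat.pred.
  assert (HP : 0 <= rho ^ k) by now apply pow_le.
  assert (Hk := pos_INR k).
  assert (H1 : Cmod w * Cmod E <= INR (S k) * INR k * rho ^ k * h).
  { apply Rle_trans with (rho * (INR (S k) * INR k * rho ^ Nat.pred k * h)).
    - apply Rmult_le_compat; auto using Cmod_ge_0.
    (* At [k = 0] the truncated predecessor is harmless, since the factor [INR 0] vanishes. *)
    - destruct k as [| k]; [simpl; lra |].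
      apply Req_le. simpl Nat.pred. simpl pow. ring. }
  assert (H2 : INR (S k) * Cmod z ^ k * h <= INR (S k) * rho ^ k * h).
  { apply Rmult_le_compat_r; [exact Hh |].
    apply Rmult_le_compat_l; [apply pos_INR |].
    now apply pow_incr. }
  rewrite !S_INR in *.
  (* The slack: [(k+2)(k+1)] exceeds [(k+1)k + (k+1)] by [k+1]. *)
  assert (H3 : 0 <= (INR k + 1) * (rho ^ k * h))
    by (apply Rmult_le_pos; [lra | now apply Rmult_le_pos]).
  lra.
Qed.

(** Multiplying the differentiated geometric sum by [(1 - rho)^2] leaves 1 minus a nonnegative
    term. *)
Lemma sum_arith_geom_le (rho : R) (n : nat) :
  0 <= rho < 1 ->
  sum_n (fun k => INR k * rho ^ Nat.pred k) n <= / (1 - rho) ^ 2.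
Proof.
intros Hrho.
assert (H : (1 - rho) ^ 2 * sum_n (fun k => INR k * rho ^ Nat.pred k) n
  = 1 - rho ^ n * (1 + INR n * (1 - rho))).
{ induction n as [| n IH].
  - rewrite sum_O. simpl. ring.
  - rewrite sum_Sn. change plus with Rplus.
    rewrite Rmult_plus_distr_l, IH, S_INR. simpl Nat.pred. simpl pow. ring. }
assert (H0 : 0 < (1 - rho) ^ 2) by (apply pow_lt; lra).
apply Rmult_le_reg_l with (1 := H0).
rewrite H, Rinv_r by lra.
assert (H1 : 0 <= rho ^ n) by now apply pow_le.
assert (H2 : 0 <= INR n * (1 - rho)) by (apply Rmult_le_pos; [apply pos_INR | lra]).
nra.
Qed.

Lemma ex_series_Cmod_bounded_coef (c : nat -> R) (z : C) :
  (forall k, 0 <= c k <= 1) -> unit_disk z ->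
  ex_series (fun k => Cmod (c k * z ^ k)).
Proof.
intros Hc Hz.
apply (@ex_series_le R_AbsRing R_CompleteNormedModule) with
  (b := fun k => Cmod z ^ k).
- intros k. change norm with Rabs. simpl.
  rewrite Rabs_pos_eq by apply Cmod_ge_0.
  rewrite Cmod_mult, Cmod_R, Cmod_pow, Rabs_pos_eq by apply Hc.
  rewrite <- (Rmult_1_l (Cmod z ^ k)) at 2.
  apply Rmult_le_compat_r; [apply pow_le, Cmod_ge_0 | apply Hc].
- apply ex_series_geom. rewrite Rabs_pos_eq; [exact Hz | apply Cmod_ge_0].
Qed.

(** The second-order remainder is summed term by term. As [INR (S k) * a k <= 1], the k-th term is
    at most [k * rho^(k-1) * |w - z|^2], and these have bounded sums. *)
Lemma is_derive_power_series (a : nat -> R) (F G : C -> C) :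
  (forall k, 0 <= INR (S k) * a k <= 1) ->
  (forall z, unit_disk z ->
     is_series (K := C_AbsRing) (V := C_NormedModule)
       (fun k => (a k * z ^ S k)%C) (F z)) ->
  (forall z, unit_disk z ->
     is_series (K := C_AbsRing) (V := C_NormedModule)
       (fun k => ((INR (S k) * a k)%R * z ^ k)%C) (G z)) ->
  forall z, unit_disk z ->
    is_derive (K := C_AbsRing) (V := C_NormedModule) F z (G z).
Proof.
intros Ha HF HG z Hz. unfold unit_disk in Hz.
assert (Hz0 := Cmod_ge_0 z).
(* The midpoint of [|z|] and 1: the disk of radius [(1 - |z|) / 2] about [z] stays inside radius
   [rho < 1]. *)
set (rho := (1 + Cmod z) / 2).
apply is_derive_of_quadratic_bound with
  (d := (1 - Cmod z) / 2) (M := / (1 - rho) ^ 2); [lra |].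
intros w Hw.
assert (Hwr : Cmod w <= rho).
{ replace w with ((w - z) + z)%C by ring.
  eapply Rle_trans; [apply Cmod_triangle |]. unfold rho. lra. }
assert (Hzr : Cmod z <= rho) by (unfold rho; lra).
assert (Hr1 : rho < 1) by (unfold rho; lra).
assert (Hwd : unit_disk w) by (unfold unit_disk; lra).
apply Cmod_series_le with
  (u := fun k => (a k * w ^ S k - a k * z ^ S k
                  - (w - z) * ((INR (S k) * a k)%R * z ^ k))%C)
  (b := fun k => Cmod (w - z) ^ 2 * (INR k * rho ^ Nat.pred k)).
- apply (is_series_minus (K := C_AbsRing) (V := C_NormedModule)).
  + apply (is_series_minus (K := C_AbsRing) (V := C_NormedModule)); auto.
  + apply (is_series_scal (K := C_AbsRing) (V := C_NormedModule)); auto.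
- intros k.
  replace (a k * w ^ S k - a k * z ^ S k
                  - (w - z) * ((INR (S k) * a k)%R * z ^ k))%C
    with (a k * (w ^ S k - z ^ S k - (w - z) * (INR (S k) * z ^ k)))%C
    by (rewrite RtoC_mult; ring).
  destruct (Ha k) as [Ha0 Ha1].
  assert (HS : 0 < INR (S k)) by (apply lt_0_INR, Nat.lt_0_succ).
  assert (Hak : 0 <= a k) by (apply Rmult_le_reg_l with (1 := HS); lra).
  rewrite Cmod_mult, Cmod_R, Rabs_pos_eq by exact Hak.
  eapply Rle_trans.
  { apply Rmult_le_compat_l; [exact Hak |].
    apply Cmod_pow_taylor2 with (1 := Hzr) (2 := Hwr). }
  set (t := Cmod (w - z) ^ 2 * (INR k * rho ^ Nat.pred k)).
  replace (a k * (INR (S k) * INR k * rho ^ Nat.pred k * Cmod (w - z) ^ 2))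
    with (INR (S k) * a k * t) by (unfold t; ring).
  rewrite <- (Rmult_1_l t) at 2.
  apply Rmult_le_compat_r; [| exact Ha1].
  apply Rmult_le_pos; [apply pow2_ge_0 |].
  apply Rmult_le_pos; [apply pos_INR | apply pow_le; lra].
- intros n.
  rewrite (sum_n_mult_l (K := R_Ring)). change mult with Rmult.
  rewrite Rmult_comm.
  apply Rmult_le_compat_r; [apply pow2_ge_0 |].
  apply sum_arith_geom_le. lra.
Qed.

(* Multiplying by [1 - z] turns the coefficients into their differences, which
   have constant sign and telescope. *)
Lemma Cmod_one_minus_mul_series_le (c : nat -> R) (z l : C) :
  c 0%nat = 1 -> (forall k, 0 <= c (S k) <= c k) -> unit_disk z ->
  is_series (K := C_AbsRing) (V := C_NormedModule) (fun k => (c k * z ^ k)%C) l ->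
  Cmod ((1 - z) * l - 1) <= Cmod z.
Proof.
intros Hc0 Hc Hz Hl. unfold unit_disk in Hz.
assert (Hz0 := Cmod_ge_0 z).
(* Removing the constant term 1 aligns the powers with those of [z * l], because
   [(1 - z) * l - 1 = (l - 1) - z * l]. *)
assert (Htail : is_series (K := C_AbsRing) (V := C_NormedModule)
  (fun k => (c (S k) * z ^ S k)%C) (l - 1)%C).
{ apply (is_series_incr_1 (K := C_AbsRing) (V := C_NormedModule)
    (fun k => (c k * z ^ k)%C)).
  change (is_series (K := C_AbsRing) (V := C_NormedModule)
    (fun k => (c k * z ^ k)%C) (l - 1 + c 0%nat * 1)%C).
  rewrite Hc0. now replace (l - 1 + 1 * 1)%C with l by ring. }
apply Cmod_series_le with
  (u := fun k => (c (S k) * z ^ S k - z * (c k * z ^ k))%C)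
  (b := fun k => Cmod z * (c k - c (S k))).
- replace ((1 - z) * l - 1)%C with ((l - 1) - z * l)%C by ring.
  apply (is_series_minus (K := C_AbsRing) (V := C_NormedModule)); [exact Htail |].
  now apply (is_series_scal (K := C_AbsRing) (V := C_NormedModule)).
- intros k. destruct (Hc k) as [H0 H1].
  replace (c (S k) * z ^ S k - z * (c k * z ^ k))%C
    with (z * ((c (S k) - c k)%R * z ^ k))%C
    by (rewrite RtoC_minus; simpl Cpow; ring).
  rewrite !Cmod_mult, Cmod_R, Cmod_pow, Rabs_minus_sym, Rabs_pos_eq by lra.
  apply Rmult_le_compat_l; [exact Hz0 |].
  rewrite <- (Rmult_1_r (c k - c (S k))) at 2.
  apply Rmult_le_compat_l; [lra |].
  rewrite <- (pow1 k). apply pow_incr. lra.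
- intros n.
  assert (Hs : sum_n (fun k => Cmod z * (c k - c (S k))) n
               = Cmod z * (1 - c (S n))).
  { induction n as [| n IH].
    - now rewrite sum_O, Hc0.
    - rewrite sum_Sn, IH. change plus with Rplus. simpl. ring. }
  rewrite Hs. destruct (Hc n) as [H0 _]. nra.
Qed.

(** * Starlikeness of [z / (1 - z)] *)

Lemma one_minus_neq_0 (z : C) : unit_disk z -> (1 - z)%C <> 0.
Proof.
unfold unit_disk. intros Hz H.
replace z with (RtoC 1) in Hz.
- rewrite Cmod_1 in Hz. lra.
- replace z with (1 - (1 - z))%C by ring. rewrite H. ring.
Qed.

Lemma is_derive_half_plane_map (z : C) : unit_disk z ->
  is_derive (K := C_AbsRing) (V := C_NormedModule)
    (fun z : C => (z / (1 - z))%C) z (/ ((1 - z) * (1 - z)))%C.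
Proof.
intros Hz. assert (Hz1 := one_minus_neq_0 z Hz). unfold unit_disk in Hz.
assert (HB : 0 < Cmod ((1 - z) * (1 - z))) by (apply Cmod_gt_0; now apply Cmult_neq_0).
set (d := (1 - Cmod z) / 2).
assert (Hd : 0 < d) by (unfold d; lra).
apply is_derive_of_quadratic_bound with (1 := Hd)
  (M := / (d * Cmod ((1 - z) * (1 - z)))).
intros w Hw.
assert (Hwm : Cmod w <= 1 - d).
{ replace w with ((w - z) + z)%C by ring.
  eapply Rle_trans; [apply Cmod_triangle |]. unfold d in *. lra. }
assert (Hw1 : (1 - w)%C <> 0) by (apply one_minus_neq_0; unfold unit_disk; lra).
assert (Hdw : d <= Cmod (1 - w)).
{ assert (H := Cmod_triangle (1 - w) w).
  replace (1 - w + w)%C with (RtoC 1) in H by ring.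
  rewrite Cmod_1 in H. lra. }
(* The remainder is exactly [(w - z)^2 / ((1 - w)(1 - z)^2)], and [|1 - w| >= d] gives the
   constant. *)
replace (w / (1 - w) - z / (1 - z) - (w - z) * / ((1 - z) * (1 - z)))%C
  with (/ ((1 - w) * ((1 - z) * (1 - z))) * (w - z) ^ 2)%C
  by (field; split; assumption).
rewrite Cmod_mult, Cmod_pow.
apply Rmult_le_compat_r; [apply pow2_ge_0 |].
rewrite Cmod_inv by (apply Cmult_neq_0; [assumption | now apply Cmult_neq_0]).
rewrite (Cmod_mult (1 - w)).
apply Rinv_le_contravar; [now apply Rmult_lt_0_compat |].
apply Rmult_le_compat_r; lra.
Qed.

Lemma Cmod_lt_Cmod_1_plus (w : C) : Cmod w < Cmod (1 + w) <-> - / 2 < Re w.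
Proof.
assert (H : Cmod (1 + w) ^ 2 - Cmod w ^ 2 = 1 + 2 * Re w).
{ rewrite !Cmod2_alt. destruct w as [x y]. simpl. ring. }
assert (H0 := Cmod_ge_0 w). assert (H1 := Cmod_ge_0 (1 + w)).
split; intros H2; nra.
Qed.

(** The inverse map is [w / (1 + w)], so [w] is in the image exactly when it is closer to 0 than to
    -1; the bisector is the line [Re w = -1/2]. *)
Lemma disk_image_half_plane_map (w : C) :
  disk_image (fun z : C => (z / (1 - z))%C) w <-> - / 2 < Re w.
Proof.
rewrite <- Cmod_lt_Cmod_1_plus. split.
- intros [z [Hz <-]]. assert (Hz1 := one_minus_neq_0 z Hz).
  replace (1 + z / (1 - z))%C with (/ (1 - z))%C by (field; assumption).
  unfold Cdiv. rewrite Cmod_mult.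
  assert (H : 0 < Cmod (/ (1 - z))).
  { rewrite Cmod_inv by assumption. now apply Rinv_0_lt_compat, Cmod_gt_0. }
  unfold unit_disk in Hz. nra.
- intros Hw. assert (H0 := Cmod_ge_0 w).
  assert (Hw1 : (1 + w)%C <> 0) by (apply Cmod_gt_0; lra).
  exists (w / (1 + w))%C. split.
  + unfold unit_disk. rewrite Cmod_div by assumption.
    apply Rlt_div_l; lra.
  + field. split; [exact Hw1 |].
    change ((1 + w - w)%C <> 0).
    replace (1 + w - w)%C with (RtoC 1) by ring.
    exact C1_nz.
Qed.

Lemma unit_disk_0 : unit_disk 0.
Proof. unfold unit_disk. rewrite Cmod_0. lra. Qed.

Lemma starlike_half_plane_map : starlike (fun z : C => (z / (1 - z))%C).
Proof.
split; [| split; [| split; [| split]]].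
- split; [| split].
  + intros z Hz. eexists. now apply is_derive_half_plane_map.
  + unfold Cdiv. ring.
  + rewrite (is_C_derive_unique _ _ _ (is_derive_half_plane_map 0 unit_disk_0)).
    field.
- intros z w Hz Hw H.
  assert (Hz1 := one_minus_neq_0 z Hz). assert (Hw1 := one_minus_neq_0 w Hw).
  assert (E : (z - w = (z / (1 - z) - w / (1 - w)) * ((1 - z) * (1 - w)))%C)
    by (field; split; assumption).
  rewrite H in E. replace z with (z - w + w)%C by ring. rewrite E. ring.
- intros w Hw. apply disk_image_half_plane_map in Hw.
  (* The distance from [w] to the boundary line; balls of [C_UniformSpace] are squares, and only the
     real component matters. *)
  assert (He : 0 < Re w + / 2) by lra.
  exists (mkposreal _ He). intros y [Hy _].
  apply disk_image_half_plane_map.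
  change (Rabs (Re y - Re w) < Re w + / 2) in Hy.
  apply Rabs_def2 in Hy. lra.
- apply disk_image_half_plane_map. simpl. lra.
- intros w t Hw Ht. apply disk_image_half_plane_map in Hw.
  apply disk_image_half_plane_map.
  replace (Re (t * w)) with (t * Re w) by (unfold Re, Cmult; simpl; ring).
  (* Either [t * Re w >= 0], or [Re w < 0] and [t * Re w >= Re w]. *)
  destruct (Rle_dec 0 (Re w)); nra.
Qed.

(** * Criterion for close-to-convexity with respect to [z / (1 - z)] *)

Lemma close_to_convex_half_plane_map (f f' : C -> C) :
  f 0 = 0 ->
  (forall z, unit_disk z ->
     is_derive (K := C_AbsRing) (V := C_NormedModule) f z (f' z)) ->
  (forall z, unit_disk z -> Cmod ((1 - z) * f' z - 1) <= Cmod z) ->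
  close_to_convex_wrt (fun z : C => (z / (1 - z))%C) f.
Proof.
intros Hf0 Hd Hb.
assert (Heq : forall z : C, unit_disk z -> z <> 0 ->
  (expi 0 * z * C_derive f z / (z / (1 - z)) = (1 - z) * f' z)%C).
{ intros z Hz Hz0. assert (Hz1 := one_minus_neq_0 z Hz).
  rewrite (is_C_derive_unique _ _ _ (Hd z Hz)).
  unfold expi. rewrite cos_0, sin_0. change (1, 0) with (RtoC 1).
  field. split; assumption. }
split; [exact starlike_half_plane_map |].
split.
{ split; [| split; [exact Hf0 |]].
  - intros z Hz. exists (f' z). now apply Hd.
  - rewrite (is_C_derive_unique _ _ _ (Hd 0 unit_disk_0)).
    assert (H := Hb 0 unit_disk_0). rewrite Cmod_0 in H.
    replace (f' 0) with (((1 - 0) * f' 0 - 1) + 1)%C by ring.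
    rewrite (Cmod_eq_0 ((1 - 0) * f' 0 - 1)); [ring |].
    apply Rle_antisym; [exact H | apply Cmod_ge_0]. }
exists 0. split.
- intros z Hz Hz0. rewrite Heq by assumption.
  assert (H := Hb z Hz). unfold unit_disk in Hz.
  assert (H1 := re_le_Cmod ((1 - z) * f' z - 1)).
  replace (Re ((1 - z) * f' z - 1)) with (Re ((1 - z) * f' z) - 1) in H1
    by (simpl; ring).
  assert (H2 : Rabs (Re ((1 - z) * f' z) - 1) < 1) by lra.
  apply Rabs_def2 in H2. lra.
- exists 1. split; [| simpl; lra].
  apply filterlim_locally. intros eps.
  assert (He := cond_pos eps).
  unfold locally', within.
  (* The bound 1 keeps [z] in the disk, where the distance to the limit is at most [|z| < eps]. *)
  apply filter_imp with (2 := locally_Cmod_lt 0 (Rmin 1 eps)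
    (Rmin_pos _ _ Rlt_0_1 He)).
  intros z Hz Hz0.
  assert (E : (z - 0 = z)%C) by ring. rewrite E in Hz. clear E.
  assert (H1 := Rmin_l 1 eps). assert (H2 := Rmin_r 1 eps).
  assert (Hzd : unit_disk z) by (unfold unit_disk; lra).
  rewrite Heq by assumption.
  apply C_NormedModule_mixin_compat1.
  apply Rle_lt_trans with (1 := Hb z Hzd). lra.
Qed.

(** * Monotonicity of the scaled coefficients of [Q] *)

(** From [ln B >= 1 - 1/B] and [exp x >= 1 + x] one gets [B^(s-1) >= 1 + (s-1)(1 - 1/B)];
    multiplying by [B] gives the claim. *)
Lemma Rpower_ge_bernoulli (B s : R) :
  0 < B -> 1 <= s -> 1 + s * (B - 1) <= Rpower B s.
Proof.
intros HB Hs.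
assert (Hln : 1 - / B <= ln B).
{ assert (H := exp_ineq1_le (- ln B)).
  rewrite exp_Ropp, exp_ln in H by exact HB. lra. }
replace s with (1 + (s - 1)) at 2 by ring.
rewrite Rpower_plus, Rpower_1 by exact HB.
assert (H : 1 + (s - 1) * (1 - / B) <= Rpower B (s - 1)).
{ apply Rle_trans with (2 := exp_ineq1_le _).
  apply Rplus_le_compat_l, Rmult_le_compat_l; lra. }
apply Rle_trans with (B * (1 + (s - 1) * (1 - / B))).
- apply Req_le. field. lra.
- apply Rmult_le_compat_l; lra.
Qed.

(* Bernoulli bounds the power of the quotient below by
   [1 + (mu + 1) * (y - x) / (x + q)]; as [q <= mu] and [1 <= x], one has
   [x + q <= (mu + 1) * x], so this is at least [y / x]. *)
Lemma Rpower_shifted_quotient_ge (mu q x y : R) :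
  0 < mu -> 0 <= q <= mu -> 1 <= x <= y ->
  y * Rpower (x + q) (mu + 1) <= x * Rpower (y + q) (mu + 1).
Proof.
intros Hmu Hq Hxy.
assert (Hyx : 0 < (y + q) / (x + q)) by (apply Rdiv_lt_0_compat; lra).
replace (y + q) with ((x + q) * ((y + q) / (x + q))) by (field; lra).
rewrite <- Rpower_mult_distr by lra.
set (P := Rpower (x + q) (mu + 1)).
assert (HP : 0 < P) by apply exp_pos.
assert (HB := Rpower_ge_bernoulli _ (mu + 1) Hyx ltac:(lra)).
set (T := Rpower ((y + q) / (x + q)) (mu + 1)) in *.
replace ((y + q) / (x + q) - 1) with ((y - x) / (x + q)) in HB by (field; lra).
enough (H : y <= x * T) by nra.
apply Rle_trans with (x * (1 + (mu + 1) * ((y - x) / (x + q)))).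
2: apply Rmult_le_compat_l; lra.
enough (H : y - x <= x * (mu + 1) * (y - x) / (x + q)) by lra.
apply Rle_div_r; [lra |].
assert (x + q <= x * (mu + 1)) by nra.
nra.
Qed.

Lemma Q_coef_1 (mu r : R) : Q_coef mu r 1 = 1.
Proof.
unfold Q_coef. simpl fact. simpl INR.
replace (1 ^ 2 + r ^ 2) with (r ^ 2 + 1) by ring.
field. apply Rgt_not_eq, exp_pos.
Qed.

(** With [m = n + 1], clearing denominators leaves [(m+1)^2 * P1 <= m * P2]. The quotient inequality
    at [x = (m!)^2], [y = ((m+1)!)^2], [q = r^2] gives [(m+1)^2 * P1 <= P2], and [m >= 1]. *)
Lemma Q_coef_scaled_decr (mu r : R) (n : nat) :
  0 < mu -> r ^ 2 <= mu ->
  INR (S (S n)) * Q_coef mu r (S (S n)) <= INR (S n) * Q_coef mu r (S n).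
Proof.
intros Hmu Hr. unfold Q_coef.
set (m := S n).
change (fact (S m)) with (S m * fact m)%nat. rewrite mult_INR.
set (F := INR (fact m)). set (N := INR (S m)).
set (K := Rpower (r ^ 2 + 1) (mu + 1)).
assert (HK : 0 < K) by apply exp_pos.
assert (HF : 1 <= F) by (change 1 with (INR 1); apply le_INR, lt_O_fact).
assert (HM : 1 <= INR m) by (change 1 with (INR 1); apply le_INR, le_n_S, Nat.le_0_l).
assert (HN : N = INR m + 1) by apply S_INR.
assert (HNF : F ^ 2 <= (N * F) ^ 2) by (apply pow_incr; nra).
assert (HF2 : 1 <= F ^ 2) by nra.
assert (H := Rpower_shifted_quotient_ge mu (r ^ 2) (F ^ 2) ((N * F) ^ 2)
  Hmu (conj (pow2_ge_0 r) Hr) (conj HF2 HNF)).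
assert (HP1 : 0 < Rpower (F ^ 2 + r ^ 2) (mu + 1)) by apply exp_pos.
assert (HP2 : 0 < Rpower ((N * F) ^ 2 + r ^ 2) (mu + 1)) by apply exp_pos.
set (P1 := Rpower (F ^ 2 + r ^ 2) (mu + 1)) in *.
set (P2 := Rpower ((N * F) ^ 2 + r ^ 2) (mu + 1)) in *.
assert (H' : N ^ 2 * P1 <= P2).
{ apply Rmult_le_reg_l with (F ^ 2); [apply pow_lt; lra |].
  replace (F ^ 2 * (N ^ 2 * P1)) with ((N * F) ^ 2 * P1) by ring. exact H. }
replace (N * (N * F * K / P2)) with (F * K * (N ^ 2 * P1) / (P1 * P2))
  by (field; lra).
replace (INR m * (F * K / P1)) with (F * K * (INR m * P2) / (P1 * P2))
  by (field; lra).
apply Rmult_le_compat_r.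
{ apply Rlt_le, Rinv_0_lt_compat. now apply Rmult_lt_0_compat. }
apply Rmult_le_compat_l; [nra |].
nra.
Qed.

Lemma Q_coef_scaled_bounds (mu r : R) (k : nat) :
  0 < mu -> r ^ 2 <= mu -> 0 <= INR (S k) * Q_coef mu r (S k) <= 1.
Proof.
intros Hmu Hr. split.
- apply Rmult_le_pos; [apply pos_INR | now apply Q_coef_bound].
- induction k as [| k IH].
  + rewrite Q_coef_1. simpl. lra.
  + eapply Rle_trans; [now apply Q_coef_scaled_decr | exact IH].
Qed.

(** * [Q] as a single power series, and the conclusion *)

(** The separate linear term of [Q] becomes the term [k = 0], because the coefficient formula gives
    1 at index 1. *)
Lemma is_series_Q (mu r : R) (z : C) :
  0 < mu -> unit_disk z ->
  is_series (K := C_AbsRing) (V := C_NormedModule)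
    (fun k => (Q_coef mu r (S k) * z ^ S k)%C) (Q mu r z).
Proof.
intros Hmu Hz.
apply (is_series_decr_1 (K := C_AbsRing) (V := C_NormedModule)).
assert (H := Q_converges mu r z Hmu Hz).
apply (is_series_ext (K := C_AbsRing) (V := C_NormedModule))
  with (b := fun k => (Q_coef mu r (S (S k)) * z ^ S (S k))%C) in H.
2: { intros k. now rewrite (Nat.add_comm k 2). }
match goal with |- is_series _ ?x =>
  match type of H with is_series _ ?y => replace x with y; [exact H |] end end.
change (CSeries (fun k : nat => (Q_coef mu r (k + 2) * z ^ (k + 2))%C)
  = (Q mu r z + - (Q_coef mu r 1 * (z * 1)))%C).
unfold Q. rewrite Q_coef_1. ring.
Qed.

Lemma Q_0 (mu r : R) : 0 < mu -> Q mu r 0 = 0.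
Proof.
intros Hmu. apply Cmod_eq_0, Rle_antisym; [| apply Cmod_ge_0].
apply Cmod_series_le with (1 := is_series_Q mu r 0 Hmu unit_disk_0) (b := fun _ => 0).
- intros k. rewrite Cmod_mult, Cmod_pow, Cmod_0. simpl. lra.
- intros n. rewrite sum_n_const. lra.
Qed.

Theorem theorem3p1 (mu r : R) (hmu : 0 < mu) (hr : 0 < r) (hr_mu : r <= sqrt mu) :
  close_to_convex_wrt (fun z : C => (z / (1 - z))%C) (Q mu r).
Proof.
assert (Hr : r ^ 2 <= mu).
{ rewrite <- (pow2_sqrt mu) by lra. apply pow_incr. lra. }
(* The coefficients of the derivative; index [k] stands for [n = k + 1], so the decreasing sequence
   starts at the value 1. *)
set (c := fun k => INR (S k) * Q_coef mu r (S k)).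
assert (HG : forall z, unit_disk z ->
  is_series (K := C_AbsRing) (V := C_NormedModule)
    (fun k => (c k * z ^ k)%C) (CSeries (fun k => (c k * z ^ k)%C))).
{ intros z Hz. apply CSeries_correct, ex_series_Cmod_bounded_coef; [| exact Hz].
  intros k. now apply Q_coef_scaled_bounds. }
apply close_to_convex_half_plane_map with
  (f' := fun z => CSeries (fun k => (c k * z ^ k)%C)).
- now apply Q_0.
- apply (is_derive_power_series (fun k => Q_coef mu r (S k))).
  + intros k. now apply Q_coef_scaled_bounds.
  + intros z Hz. now apply is_series_Q.
  + exact HG.
- intros z Hz. apply Cmod_one_minus_mul_series_le with (c := c);
    [| | exact Hz | now apply HG].
  + unfold c. rewrite Q_coef_1. simpl. lra.
  + intros k. split.
    * now apply Q_coef_scaled_bounds.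
    * now apply Q_coef_scaled_decr.
Qed.
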